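(* Let $k \geq 1$ be an integer and let $G$ be a perfectly $k$-divisible graph with clique number $\omega = \omega(G)$. Then $$\chi(G) \leq \binom{\omega + k - 1}{k}.$$
   Context: All graphs are finite, simple and undirected. $\omega(G)$ denotes the clique number and $\chi(G)$ the chromatic number of $G$; $G[X]$ is the subgraph induced by $X \subseteq V(G)$. A graph $G$ is perfect if $\chi(H)=\omega(H)$ for every induced subgraph $H$ of $G$. A graph $G$ is perfectly $1$-divisible if $G$ is perfect. For an integer $k>1$, a graph $G$ is perfectly $k$-divisible if for every induced subgraph $H$ of $G$, either $V(H)$ is a stable set or $V(H)$ admits a partition into two sets $X_1, X_2$ such that $\omega(H[X_1]) < \omega(H)$ and $H[X_2]$ is perfectly $(k-1)$-divisible. *)

(* Defs.v *)
From mathcomp Require Import all_boot.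
Set Implicit Arguments.
Unset Strict Implicit.
Unset Printing Implicit Defensive.

Record sgraph := SGraph {
  vertex :> finType;
  adj : rel vertex;
  adj_sym : symmetric adj;
  adj_irr : irreflexive adj
}.

Definition induced_adj (G : sgraph) (A : {set G}) : rel {x : G | x \in A} :=
  fun u v => adj (val u) (val v).

Lemma induced_adj_sym (G : sgraph) (A : {set G}) : symmetric (@induced_adj G A).
Proof. by move=> u v; apply: adj_sym. Qed.

Lemma induced_adj_irr (G : sgraph) (A : {set G}) :
  irreflexive (@induced_adj G A).
Proof. by move=> u; apply: adj_irr. Qed.

Definition induced (G : sgraph) (A : {set G}) : sgraph :=
  SGraph (@induced_adj_sym G A) (@induced_adj_irr G A).

Definition clique (G : sgraph) (K : {set G}) : bool :=
  [forall x in K, forall y in K, (x != y) ==> adj x y].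

Definition stable (G : sgraph) (S : {set G}) : bool :=
  [forall x in S, forall y in S, ~~ adj x y].

Definition omega (G : sgraph) : nat := \max_(K : {set G} | clique K) #|K|.

Definition colourable (G : sgraph) (n : nat) : bool :=
  [exists f : {ffun G -> 'I_n},
     [forall x, forall y, adj x y ==> (f x != f y)]].

Lemma colourable_ex (G : sgraph) : exists n, colourable G n.
Proof.
exists #|G|; apply/existsP; exists [ffun x : G => enum_rank x].
apply/forallP=> x; apply/forallP=> y; apply/implyP=> xy; rewrite !ffunE.
by apply: contraTneq xy => /enum_rank_inj ->; rewrite adj_irr.
Qed.

Definition chi (G : sgraph) : nat := ex_minn (colourable_ex G).

Definition perfect (G : sgraph) : Prop :=
  forall A : {set G}, chi (induced A) = omega (induced A).

(* The notion is only defined for k >= 1; the value False at k = 0 is junk. *)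
Fixpoint perfectly_divisible (k : nat) (G : sgraph) {struct k} : Prop :=
  match k with
  | 0 => False
  | 1 => perfect G
  | (_.+1 as k').+1 =>
      forall A : {set G}, let H := induced A in
        stable [set: H] \/
        exists X1 X2 : {set H},
          [/\ X1 :|: X2 = [set: H], [disjoint X1 & X2],
              omega (induced X1) < omega H &
              perfectly_divisible k' (induced X2)]
  end.

(* Main.v *)
Require Import Defs.
From mathcomp Require Import all_boot.

Set Implicit Arguments.
Unset Strict Implicit.
Unset Printing Implicit Defensive.

(** Induction on [k], and for fixed [k] on a bound for the clique number.  In
    the partition [X1], [X2] given by divisibility, [X1] is again perfectly
    [k]-divisible with smaller clique number, because the property is
    hereditary, and [X2] is perfectly [(k-1)]-divisible.  Colouring the two
    parts with disjoint palettes, the bounds add up by Pascal's rule. *)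

(** Iterated induced subgraphs live on nested subtypes and are never literally equal, so invariants
    are transported along these maps instead. *)
Definition embedding (H G : sgraph) (f : H -> G) : Prop :=
  injective f /\ forall x y, adj (f x) (f y) = adj x y.

Lemma val_embedding (G : sgraph) (A : {set G}) :
  @embedding (induced A) G val.
Proof. by split=> //; apply: val_inj. Qed.

Lemma embedding_restrict (H G : sgraph) (f : H -> G) (A : {set H})
    (B : {set G}) :
  embedding f -> (forall x, x \in A -> f x \in B) ->
  exists2 g : induced A -> induced B,
    embedding g & forall x, val (g x) = f (val x).
Proof.
move=> [finj fadj] fAB.
exists (fun x : induced A => exist _ (f (val x)) (fAB _ (valP x))) => //.
by split=> [x y [] /finj /val_inj //|x y]; apply: fadj.
Qed.

Lemma embedding_inv (H G : sgraph) (f : H -> G) (g : G -> H) :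
  embedding f -> cancel g f -> embedding g.
Proof.
by move=> [_ fadj] gK; split=> [|x y]; [apply: can_inj gK | rewrite -fadj !gK].
Qed.

Lemma embedding_to_induced (G : sgraph) :
  exists g : G -> induced [set: G], embedding g.
Proof.
exists (fun x => exist _ x (in_setT x)).
by split=> [x y []|].
Qed.

(** The restriction of [f] is injective between types of equal cardinality, hence bijective, and its
    inverse is again an embedding. Having both directions turns monotonicity of [omega] and [chi]
    into invariance. *)
Lemma embedding_imset (H G : sgraph) (f : H -> G) (A : {set H}) :
  embedding f ->
  exists (g : induced A -> induced (f @: A)) (h : induced (f @: A) -> induced A),
    embedding g /\ embedding h.
Proof.
move=> fE.
have [g gE _] := embedding_restrict fE (fun x => @imset_f _ _ f (mem A) x).
have [|h _ hK] := inj_card_bij gE.1.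
  by rewrite /= !card_sig card_imset //; case: fE.
by exists g, h; split=> //; apply: embedding_inv gE hK.
Qed.

Lemma cliqueP (G : sgraph) (K : {set G}) :
  reflect {in K &, forall x y, x != y -> adj x y} (clique K).
Proof.
apply: (iffP forall_inP) => KP x => [y xK yK xy | xK].
  by have /forall_inP/(_ y yK)/implyP := KP x xK; apply.
by apply/forall_inP=> y yK; apply/implyP/KP.
Qed.

Lemma clique_leq_omega (G : sgraph) (K : {set G}) :
  clique K -> #|K| <= omega G.
Proof. exact: (@leq_bigmax_cond _ _ (fun K : {set G} => #|K|) K). Qed.

Lemma leq_omega_embedding (H G : sgraph) (f : H -> G) :
  embedding f -> omega H <= omega G.
Proof.
move=> [finj fadj]; apply/bigmax_leqP=> K /cliqueP Kcl.
rewrite -(card_imset K finj); apply: clique_leq_omega.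
apply/cliqueP=> _ _ /imsetP[x xK ->] /imsetP[y yK ->] fxy.
by rewrite fadj Kcl //; apply: contra_neq fxy => ->.
Qed.

Lemma omega_gt0 (G : sgraph) : G -> 0 < omega G.
Proof.
move=> x; rewrite -(cards1 x); apply: clique_leq_omega.
by apply/cliqueP=> y z /set1P-> /set1P->; rewrite eqxx.
Qed.

Lemma colourableP (G : sgraph) (n : nat) :
  reflect (exists f : G -> 'I_n, forall x y, adj x y -> f x != f y)
    (colourable G n).
Proof.
apply: (iffP existsP) => [[f fP]|[f fP]].
  by exists f => x y; apply/implyP; move/forallP/(_ x)/forallP: fP; apply.
exists [ffun x => f x]; apply/forallP=> x; apply/forallP=> y.
by apply/implyP=> xy; rewrite !ffunE fP.
Qed.

Lemma chi_colourable (G : sgraph) : colourable G (chi G).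
Proof. by rewrite /chi; case: ex_minnP. Qed.

Lemma chi_leq (G : sgraph) (n : nat) : colourable G n -> chi G <= n.
Proof. by rewrite /chi; case: ex_minnP => m _; apply. Qed.

Lemma leq_chi_embedding (H G : sgraph) (f : H -> G) :
  embedding f -> chi H <= chi G.
Proof.
move=> [_ fadj]; have /colourableP[c cP] := chi_colourable G.
apply/chi_leq/colourableP; exists (c \o f) => x y xy.
by apply: cP; rewrite fadj.
Qed.

Lemma chi_leq_setU (G : sgraph) (X Y : {set G}) :
  X :|: Y = [set: G] -> chi G <= chi (induced X) + chi (induced Y).
Proof.
move=> XY.
have /colourableP[c cP] := chi_colourable (induced X).
have /colourableP[d dP] := chi_colourable (induced Y).
have Yx x : x \notin X -> x \in Y.
  by move=> xX; have := in_setT x; rewrite -XY inE (negPf xX).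
apply/chi_leq/colourableP.
(* Vertices of [X] use the left part of the palette, all others the right part. Matching on [boolP]
   supplies the membership proofs needed to form vertices of the induced subgraphs. *)
pose col x := match boolP (x \in X) with
  | AltTrue xX => lshift _ (c (exist _ x xX))
  | AltFalse xX => rshift _ (d (exist _ x (Yx x xX))) end.
exists col => x y xy; rewrite /col.
case: {-}_ / boolP => xX; case: {-}_ / boolP => yX.
- by rewrite (inj_eq (@lshift_inj _ _)); apply: cP.
- by rewrite eq_lrshift.
- by rewrite eq_rlshift.
- by rewrite (inj_eq (@rshift_inj _ _)); apply: dP.
Qed.

Lemma stableP (G : sgraph) (S : {set G}) :
  reflect {in S &, forall x y, ~~ adj x y} (stable S).
Proof.
apply: (iffP forall_inP) => SP x => [y xS yS | xS].
  by have /forall_inP/(_ y yS) := SP x xS.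
by apply/forall_inP=> y yS; apply: SP.
Qed.

Lemma stable_embedding (H G : sgraph) (f : H -> G) :
  embedding f -> stable [set: G] -> stable [set: H].
Proof.
move=> [_ fadj] /stableP Gst; apply/stableP=> x y _ _.
by rewrite -fadj Gst ?in_setT.
Qed.

Lemma chi_stable (G : sgraph) : stable [set: G] -> chi G <= 1.
Proof.
move=> /stableP Gst; apply/chi_leq/colourableP; exists (fun=> ord0) => x y.
by rewrite (negPf (Gst x y _ _)) ?in_setT.
Qed.

Lemma perfect_embedding (H G : sgraph) (f : H -> G) :
  embedding f -> perfect G -> perfect H.
Proof.
move=> fE Gperf A; have [g [h [gE hE]]] := embedding_imset A fE.
apply: etrans (etrans (Gperf (f @: A)) _).
  by apply/eqP; rewrite eqn_leq !(leq_chi_embedding gE, leq_chi_embedding hE).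
by apply/eqP; rewrite eqn_leq (leq_omega_embedding gE) (leq_omega_embedding hE).
Qed.

(** A subset [A] of [H] is handled by splitting its image in [G] and pulling the two parts back
    along [g]. The reverse map [h] keeps the drop in clique number strict. *)
Lemma perfectly_divisible_embedding (k : nat) (H G : sgraph) (f : H -> G) :
  embedding f -> perfectly_divisible k G -> perfectly_divisible k H.
Proof.
elim: k H G f => [//|[_|k IHk]] H G f fE; first exact: perfect_embedding fE.
move=> Gdiv A; have [g [h [gE hE]]] := embedding_imset A fE.
have [st|[X1 [X2 [X12 dX ltX1 divX2]]]] := Gdiv (f @: A).
  by left; apply: stable_embedding gE st.
have restr (X : {set induced (f @: A)}) :
    exists g' : induced (g @^-1: X) -> induced X, embedding g'.
  have [|g' g'E _] := embedding_restrict (A := g @^-1: X) (B := X) gE.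
    by move=> x; rewrite inE.
  by exists g'.
right; exists (g @^-1: X1), (g @^-1: X2); split.
- by rewrite -preimsetU X12 preimsetT.
- by rewrite -setI_eq0 -preimsetI (disjoint_setI0 dX) preimset0.
- have [g1 g1E] := restr X1.
  apply: leq_ltn_trans (leq_omega_embedding g1E) _.
  exact: leq_trans ltX1 (leq_omega_embedding hE).
- have [g2 g2E] := restr X2; exact: IHk g2E divX2.
Qed.

(** Replacing [omega G] by a bound [n] allows a nested induction on [n], and shifting [k] avoids
    truncated subtraction. *)
Lemma chi_leq_bin (k n : nat) (G : sgraph) :
  perfectly_divisible k.+1 G -> omega G <= n -> chi G <= 'C(n + k, k.+1).
Proof.
elim: k n G => [|k IHk] n.
  move=> G Gperf Gn; rewrite addn0 bin1.
  have [e eE] := embedding_to_induced G.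
  apply: leq_trans (leq_chi_embedding eE) _; rewrite Gperf.
  exact: leq_trans (leq_omega_embedding (val_embedding _)) Gn.
elim: n => [|n IHn] G Gdiv Gn.
  (* A vertex would be a clique of size 1, so [G] is empty and needs no colours. *)
  apply: leq_trans (leq0n _); apply/chi_leq/colourableP.
  have G0 (x : G) : False by have := leq_trans (omega_gt0 x) Gn.
  by exists (fun x => False_rect _ (G0 x)) => x; have := G0 x.
have [e eE] := embedding_to_induced G.
apply: leq_trans (leq_chi_embedding eE) _.
(* Divisibility splits the copy of [G] induced on its full vertex set, hence the detour through
   [e]. *)
have [/chi_stable st|[X1 [X2 [X12 _ ltX1 divX2]]]] := Gdiv [set: G].
  by apply: leq_trans st _; rewrite bin_gt0 addSn ltnS leq_addl.
have TG := val_embedding [set: G].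
have wT := leq_trans (leq_omega_embedding TG) Gn.
(* Pascal's rule leaves ['C(n + k.+1, k.+2)] for [X1], with clique number at most [n], and
   ['C(n + k.+1, k.+1)] for [X2], which is the bound for [k] at [n.+1]. *)
apply: leq_trans (chi_leq_setU X12) _; rewrite addSn binS.
apply: leq_add.
- apply: IHn; last by rewrite -ltnS (leq_trans ltX1).
  apply: perfectly_divisible_embedding (val_embedding X1) _.
  exact: perfectly_divisible_embedding TG Gdiv.
- rewrite addnS -addSn; apply: IHk divX2 _.
  exact: leq_trans (leq_omega_embedding (val_embedding X2)) wT.
Qed.

Theorem theorem1 (k : nat) (hk : 1 <= k) (G : sgraph)
  (hG : perfectly_divisible k G) :
  chi G <= 'C(omega G + k - 1, k).
Proof.
case: k hk hG => // k _ hG; rewrite addnS subn1.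
exact: chi_leq_bin hG (leqnn _).
Qed.
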